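(* Let $k$ be an arbitrary field (of any characteristic), let $X$ be an affine variety over $k$, let $\phi: X\to X$ be a morphism, let $\alpha\in X$ be a point, and let $V$ be a Zariski-closed subset of $X$. If the set $\{n\in\mathbb{N}\mid\phi^n(\alpha)\in V\}$ contains no infinite arithmetic progressions, then it has Banach density zero.
   Context: An affine variety over a field $k$ means $X=\mathrm{Spec}(A)$ for a finitely generated (commutative, unital) $k$-algebra $A$; no irreducibility or reducedness is assumed. A morphism $\phi:X\to X$ is a morphism of $k$-schemes, i.e. it is given by $\phi(\mathfrak{p})=\Phi^{-1}(\mathfrak{p})$ for a $k$-algebra homomorphism $\Phi:A\to A$. A point of $X$ is any element of $\mathrm{Spec}(A)$ (a prime ideal of $A$), not assumed to be a closed point. $\mathbb{N}$ denotes the set of nonnegative integers, and $\phi^n=\phi\circ\cdots\circ\phi$ is the $n$-fold composition of $\phi$ with itself ($\phi^0$ is the identity). An infinite arithmetic progression is a set of the form $a\mathbb{N}+b=\{a\ell+b\mid \ell\in\mathbb{N}\}$ with integers $a\geq 1$ and $b\geq 0$. The Banach density of a subset $S\subseteq\mathbb{N}$ is $$d(S)=\limsup_{|I|\to+\infty}\frac{|S\cap I|}{|I|},$$ the limit supremum taken over all (finite, nonempty) intervals $I$ of consecutive integers in $\mathbb{N}$ with $|I|\to+\infty$. *)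

(* Defs.v *)
From HB Require Import structures.
From mathcomp Require Import all_boot all_order all_algebra.
From mathcomp Require Export ring_quotient.
From mathcomp Require Import all_classical all_reals all_analysis.

Set Implicit Arguments.
Unset Strict Implicit.
Unset Printing Implicit Defensive.

Import Order.TTheory GRing.Theory Num.Theory.
Local Open Scope ring_scope.
Local Open Scope classical_set_scope.

Definition finitely_generated_algebra (k : fieldType) (A : comAlgType k)
  : Prop :=
  exists s : seq A, forall S : {pred A},
    GRing.subalg_closed S -> {subset s <= S} -> forall a : A, a \in S.

(* [prime_idealr] packs boolean predicates; by the classical axioms of         *)
(* [boolp], these are the same as arbitrary subsets of [A].                    *)
Definition Spec (A : comNzRingType) : Type := prime_idealr A.

Definition comap (A B : comNzRingType) (Phi : {rmorphism A -> B})
  (p : prime_idealr B) : {pred A} := fun a => Phi a \in p.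

Section Comap.
Variables (A B : comNzRingType) (Phi : {rmorphism A -> B}).
Variable p : prime_idealr B.

Lemma mem_comap a : (a \in comap Phi p) = (Phi a \in p).
Proof. by []. Qed.

Lemma comap_idealr_closed : idealr_closed (comap Phi p).
Proof.
split; rewrite ?mem_comap.
- by rewrite rmorph0 idealr0.
- by rewrite rmorph1 idealr1.
move=> a u v; rewrite !mem_comap rmorphD rmorphM => up vp.
by apply: rpredD => //; apply: idealMr.
Qed.

Lemma comap_prime : prime_idealr_closed (comap Phi p).
Proof. by move=> u v; rewrite !mem_comap rmorphM prime_idealrM. Qed.

HB.instance Definition _ := isIdealr.Build A (comap Phi p) comap_idealr_closed.
HB.instance Definition _ :=
  isPrimeIdealrClosed.Build A (comap Phi p) comap_prime.
End Comap.

Definition Spec_map (A B : comNzRingType) (Phi : {rmorphism A -> B})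
  (p : Spec B) : Spec A := comap Phi p : prime_idealr A.

Definition zero_locus (A : comNzRingType) (E : set A) : set (Spec A) :=
  [set p | forall f : A, E f -> f \in p].

Definition zariski_closed (A : comNzRingType) (V : set (Spec A)) : Prop :=
  exists E : set A, V = zero_locus E.

Definition arithmetic_progression (a b : nat) : set nat :=
  [set (a * l + b)%N | l in [set: nat]].

(* A pair [(m, l)] encodes the interval [{m, m + 1, ..., m + l - 1}] of        *)
(* length [l]; the filter below is the one of "[l] tends to infinity".         *)
Definition long_intervals : set_system (nat * nat) :=
  [set P | exists N : nat, forall I : nat * nat, (N <= I.2)%N -> P I].

(* The value at intervals of length 0 does not affect the density.             *)
Definition interval_density (R : realType) (S : set nat) (I : nat * nat) : R :=
  (\sum_(I.1 <= n < I.1 + I.2) (n \in S))%N%:R / I.2%:R.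

Definition banach_density (R : realType) (S : set nat) : \bar R :=
  limf_esup (fun I => (interval_density R S I)%:E) long_intervals.

(* Main.v *)
(* If the return set of [V] has positive density, choose by noetherianity a    *)
(* minimal closed [W] in [V] whose return set still has positive density.      *)
(* A set of positive density meets one of its shifts, by some [a > 0], in a    *)
(* set of positive density; for the return set of [W] this intersection is     *)
(* the return set of the closed set [W `&` phi^-a W], which is therefore [W]   *)
(* by minimality.  Hence [phi^a] maps [W] into itself, and any return time [b] *)
(* to [W] gives the progression [a * l + b] of return times to [V].            *)

Require Import Defs.
From mathcomp Require Import all_boot all_order all_algebra.
From mathcomp Require Import all_classical all_reals all_analysis.
From mathcomp Require Import zify.

Set Implicit Arguments.
Unset Strict Implicit.
Unset Printing Implicit Defensive.

Import Order.TTheory GRing.Theory Num.Theory.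
Local Open Scope ring_scope.
Local Open Scope classical_set_scope.

(** Two finiteness facts meet. Combinatorially, if a set meets each of its nontrivial shifts in
    density zero, then up to a negligible part its elements are at least [K] apart, so its density
    is at most 1 / [K], for every [K] ([zero_density_shifts]). Algebraically, [A] is a quotient of
    an iterated polynomial ring over [k], hence noetherian by [hilbert_basis], and families of
    closed sets have minimal members ([zariski_closed_min]). A minimal [W] whose return set is not
    negligible must then be stable under some [phi^a], since the simultaneous return times to [W] at
    [n] and [n + a] are the return times to a closed subset of [W] ([zariski_closed_return]). *)

(** * Ideals and noetherian rings *)

Record is_ideal (R : comNzRingType) (I : set R) : Prop := IsIdeal {
  ideal0 : I 0;
  idealD : forall x y, I x -> I y -> I (x + y);
  idealM : forall a x, I x -> I (a * x) }.

Lemma idealB (R : comNzRingType) (I : set R) x y :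
  is_ideal I -> I x -> I y -> I (x - y).
Proof.
by move=> hI Ix Iy; apply: idealD => //; rewrite -mulN1r; apply: idealM.
Qed.

(* Being generated by [s] is expressed through the ideals containing [s],      *)
(* which avoids linear combinations.                                           *)
Definition noetherian (R : comNzRingType) : Prop :=
  forall I : set R, is_ideal I -> exists s : seq R,
    [set` s] `<=` I /\
    forall J : set R, is_ideal J -> [set` s] `<=` J -> I `<=` J.

Lemma is_ideal_preimage (R A : comNzRingType) (f : {rmorphism R -> A})
  (I : set A) : is_ideal I -> is_ideal (f @^-1` I).
Proof.
move=> hI; split=> [|x y Ix Iy|a x Ix] /=.
- by rewrite rmorph0; exact: ideal0.
- by rewrite rmorphD; apply: idealD.
- by rewrite rmorphM; apply: idealM.
Qed.

Lemma is_ideal_bigcup (R : comNzRingType) (I : nat -> set R) :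
  (forall n, is_ideal (I n)) -> (forall m n, (m <= n)%N -> I m `<=` I n) ->
  is_ideal (\bigcup_n I n).
Proof.
move=> hI mono; split=> [|x y [m _ Ix] [n _ Iy]|a x [n _ Ix]].
- by exists 0%N => //; exact: ideal0.
- exists (maxn m n) => //; apply: idealD => //.
    exact: mono (leq_maxl _ _) _ Ix.
  exact: mono (leq_maxr _ _) _ Iy.
- by exists n => //; apply: idealM.
Qed.

(** The union of the chain is an ideal, and its finitely many generators already lie in a single
    member. *)
Lemma noetherian_chain (R : comNzRingType) (I : nat -> set R) :
  noetherian R -> (forall n, is_ideal (I n)) ->
  (forall m n, (m <= n)%N -> I m `<=` I n) ->
  exists N, forall n, I n `<=` I N.
Proof.
move=> nR hI mono; have [s [sI sP]] := nR _ (is_ideal_bigcup hI mono).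
suff [N sN] : exists N, [set` s] `<=` I N.
  exists N => n x Ix; apply: (sP (I N)) => //; by exists n.
elim: s sI {sP} => [|y s IHs] sI; first by exists 0%N => x.
have [N sN] := IHs (fun x xs => sI x (mem_behead (s := y :: s) xs)).
have [n _ Iy] := sI y (mem_head y s).
exists (maxn n N) => x /=; rewrite inE => /orP[/eqP ->|xs].
  exact: mono (leq_maxl _ _) _ Iy.
exact: mono (leq_maxr _ _) _ (sN _ xs).
Qed.

Lemma noetherian_field (k : fieldType) : noetherian k.
Proof.
move=> I hI; have [[x Ix x0]|I0] := pselect (exists2 x, I x & x != 0).
  exists [:: x]; split=> [y /=|J hJ sJ y _]; first by rewrite inE => /eqP ->.
  by rewrite -(mulfVK x0 y); apply: idealM => //; apply: sJ => /=; rewrite inE.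
exists [::]; split=> [y //|J hJ _ y Iy].
have [->|y0] := eqVneq y 0; first exact: ideal0.
by case: I0; exists y.
Qed.

Lemma noetherian_surj (R A : comNzRingType) (f : {rmorphism R -> A}) :
  (forall a, range f a) -> noetherian R -> noetherian A.
Proof.
move=> fS nR I hI; have [s [sI sP]] := nR _ (is_ideal_preimage f hI).
exists (map f s); split=> [_ /mapP[x xs ->]|J hJ sJ a Ia]; first exact: sI.
have [x _ fx] := fS a; rewrite -fx; apply: (sP (f @^-1` J)).
- exact: is_ideal_preimage.
- by move=> y ys; apply: sJ; apply/mapP; exists y.
- by rewrite /= fx.
Qed.

(** * Hilbert's basis theorem *)

(* The coefficients at ['X^n] of the elements of [I] of degree at most [n]:    *)
(* allowing smaller degrees adds only [0] and makes this an ideal.             *)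
Definition coef_ideal (R : comNzRingType) (I : set {poly R}) (n : nat) :
  set R :=
  [set c | exists p, [/\ I p, (size p <= n.+1)%N & p`_n = c]].

Lemma is_ideal_coef (R : comNzRingType) (I : set {poly R}) n :
  is_ideal I -> is_ideal (coef_ideal I n).
Proof.
move=> hI; split=> [|_ _ [p [Ip sp <-]] [q [Iq sq <-]]|a _ [p [Ip sp <-]]].
- by exists 0; rewrite size_poly0 coef0; split=> //; exact: ideal0.
- exists (p + q); rewrite coefD; split=> //; first exact: idealD.
  by rewrite (leq_trans (size_polyD _ _))// geq_max sp.
- exists (a%:P * p); rewrite coefCM; split=> //; first exact: idealM.
  by rewrite mul_polyC (leq_trans (size_scale_leq _ _)).
Qed.

Lemma coef_ideal_mono (R : comNzRingType) (I : set {poly R}) m n :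
  is_ideal I -> (m <= n)%N -> coef_ideal I m `<=` coef_ideal I n.
Proof.
move=> hI mn _ [p [Ip sp <-]]; exists ('X^(n - m) * p); split.
- exact: idealM.
- have [->|p0] := eqVneq p 0; first by rewrite mulr0 size_poly0.
  by rewrite mulrC size_mulXn//; lia.
- by rewrite coefXnM ltnNge leq_subr subKn.
Qed.

(** Subtracting from [p] an element of [J] with the same top coefficient lowers the size bound while
    staying in [I]. *)
Lemma coef_ideal_sub (R : comNzRingType) (I J : set {poly R}) :
  is_ideal I -> is_ideal J -> J `<=` I ->
  (forall n, coef_ideal I n `<=` coef_ideal J n) -> I `<=` J.
Proof.
move=> hI hJ JI cIJ p; move: {2}(size p) (leqnn (size p)) => n.
elim: n p => [|n IHn] p sp Ip.
  by move: sp; rewrite leqn0 size_poly_eq0 => /eqP ->; exact: ideal0.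
have [|q [Jq sq pq]] := cIJ n p`_n; first by exists p.
rewrite -(subrK q p); apply: idealD => //; apply: IHn; last first.
  by apply: idealB => //; exact: JI.
apply/leq_sizeP => j nj; rewrite coefB.
have [<-|jn] := eqVneq n j; first by rewrite pq subrr.
have nj' : (n < j)%N by rewrite ltn_neqAle jn.
by rewrite !nth_default ?subrr// (leq_trans _ nj').
Qed.

(** [J] ranges over all sets, so lifts obtained for different [n] can be concatenated. *)
Lemma lift_coef_ideal (R : comNzRingType) (I : set {poly R}) n (s : seq R) :
  [set` s] `<=` coef_ideal I n -> exists t : seq {poly R}, [set` t] `<=` I /\
    forall J, [set` t] `<=` J -> [set` s] `<=` coef_ideal J n.
Proof.
elim: s => [|c s IHs] sI; first by exists [::]; split.
have [t [tI tP]] := IHs (fun x xs => sI x (mem_behead (s := c :: s) xs)).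
have [p [Ip sp pc]] := sI c (mem_head c s).
exists (p :: t); split=> [q|J tJ x] /=; rewrite inE => /orP[].
- by move/eqP->.
- exact: tI.
- by move/eqP->; exists p; split=> //; apply: tJ => /=; rewrite mem_head.
- by apply: tP => q qt; apply: tJ => /=; rewrite inE qt orbT.
Qed.

(** The coefficient ideals of [I] are constant from some [N] on; lifted generators of those of index
    at most [N] generate [I]. *)
Theorem hilbert_basis (R : comNzRingType) :
  noetherian R -> noetherian {poly R}.
Proof.
move=> nR I hI.
have [N LN] := noetherian_chain nR (fun n => is_ideal_coef n hI)
  (fun m n => coef_ideal_mono hI).
have [t [tI tP]] : exists t : seq {poly R}, [set` t] `<=` I /\
    forall J, is_ideal J -> [set` t] `<=` J ->
    forall n, (n < N.+1)%N -> coef_ideal I n `<=` coef_ideal J n.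
  elim: N.+1 => [|m [t [tI tP]]]; first by exists [::]; split.
  have [s [sI sP]] := nR _ (is_ideal_coef m hI).
  have [u [uI uP]] := lift_coef_ideal sI.
  exists (u ++ t); split=> [q|J hJ tJ n] /=.
    by rewrite mem_cat => /orP[/uI|/tI].
  rewrite ltnS leq_eqVlt => /orP[/eqP ->|nm].
    apply: sP; first exact: is_ideal_coef.
    by apply: uP => q qu; apply: tJ => /=; rewrite mem_cat qu.
  by apply: tP => // q qt; apply: tJ => /=; rewrite mem_cat qt orbT.
exists t; split=> // J hJ tJ.
(* [coef_ideal_sub] compares nested ideals, so [J] is replaced by its intersection with [I]. *)
suff: I `<=` I `&` J by move=> IJ p /IJ[].
have hIJ : is_ideal (I `&` J).
  split=> [|x y [Ix Jx] [Iy Jy]|a x [Ix Jx]].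
  - by split; exact: ideal0.
  - by split; exact: idealD.
  - by split; exact: idealM.
have tIJ : [set` t] `<=` I `&` J by move=> q qt; split; [exact: tI|exact: tJ].
apply: coef_ideal_sub => // n.
have [nN|Nn] := leqP n N; first exact: tP.
apply: (subset_trans (LN n)); apply: (subset_trans (tP _ hIJ tIJ N _)) => //.
exact: coef_ideal_mono (ltnW Nn).
Qed.

(** * Finitely generated algebras; maximal members of families of ideals *)

(** Induction on [s]: a generator [x] is absorbed by passing from [R] to [{poly R}] and from [f] to
    evaluation at [x]; with none left, [f] is onto. *)
Lemma noetherian_generated (R A : comNzRingType) (f : {rmorphism R -> A})
  (s : seq A) : noetherian R ->
  (forall S : set A, range f `<=` S -> [set` s] `<=` S ->
    (forall x y, S x -> S y -> S (x - y)) ->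
    (forall x y, S x -> S y -> S (x * y)) -> forall a, S a) ->
  noetherian A.
Proof.
elim: s R f => [|x s IHs] R f nR gen.
  apply: (noetherian_surj (f := f)) => // a; apply: gen => //.
  - by move=> _ _ [y _ <-] [z _ <-]; exists (y - z) => //; rewrite rmorphB.
  - by move=> _ _ [y _ <-] [z _ <-]; exists (y * z) => //; rewrite rmorphM.
have cfx : commr_rmorph f x by move=> a; rewrite /GRing.comm mulrC.
apply: (IHs _ (horner_morph cfx)) => [|S fS sS SB SM].
  exact: hilbert_basis.
apply: gen => // [_ [c _ <-]|y /=].
  by apply: fS; exists c%:P => //; exact: horner_morphC.
rewrite inE => /orP[/eqP ->|]; last exact: sS.
by apply: fS; exists 'X => //; exact: horner_morphX.
Qed.

Lemma finitely_generated_noetherian (k : fieldType) (A : comAlgType k) :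
  finitely_generated_algebra A -> noetherian A.
Proof.
move=> [s gen]; apply: (noetherian_generated (f := GRing.in_alg A) (s := s)).
  exact: noetherian_field.
move=> S kS sS SB SM a; apply/asboolP.
have S1 : S 1 by apply: kS; exists 1 => //; rewrite rmorph1.
apply: (gen (fun b => `[<S b>])) => [|b bs]; last exact/asboolP/sS.
split=> [|c u v|u v]; rewrite /in_mem /=.
- exact/asboolP.
- move=> /asboolP Su /asboolP Sv; apply/asboolP.
  have S0 : S 0 by rewrite -(subrr 1); exact: SB.
  (* [S] is closed under differences, so the sum is written as [c *: u - (0 - v)]. *)
  rewrite -[v]opprK -[- v]sub0r -mulr_algl; apply: (SB); last exact: SB.
  by apply: SM => //; apply: kS; exists c.
- by move=> /asboolP Su /asboolP Sv; apply/asboolP/SM.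
Qed.

(** Without a maximal member, choice builds a strictly increasing chain, against
    [noetherian_chain]. *)
Lemma noetherian_max (R : comNzRingType) (F : set (set R)) :
  noetherian R -> F `<=` @is_ideal R -> F !=set0 ->
  exists2 I, F I & forall J, F J -> I `<=` J -> J `<=` I.
Proof.
move=> nR hF [I0 FI0]; apply: contrapT => nomax.
have step (I : {I | F I}) : exists J : {I | F I},
    sval I `<=` sval J /\ ~ sval J `<=` sval I.
  apply: contrapT => nJ; apply: nomax; exists (sval I); first exact: svalP I.
  move=> J FJ IJ; apply: contrapT => nJI; apply: nJ.
  by exists (exist _ J FJ).
have [g gP] := choice step.
pose I n := sval (iter n g (exist _ I0 FI0)).
have mono m n : (m <= n)%N -> I m `<=` I n.
  move=> /subnK <-; elim: (n - m)%N => [//|d IHd].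
  by apply: (subset_trans IHd); exact: (gP _).1.
have [N /(_ N.+1)] := noetherian_chain nR
  (fun n => hF _ (svalP (iter n g (exist _ I0 FI0)))) mono.
exact: (gP _).2.
Qed.

(** * Banach density zero and shifts *)

Definition count_in (S : set nat) (m l : nat) : nat :=
  (\sum_(m <= n < m + l) (n \in S))%N.

(** Density zero in integer arithmetic: proportion at most 1 / [q] on long intervals, uniformly in
    their start. *)
Definition zero_density (S : set nat) : Prop :=
  forall q : nat, exists N : nat, forall m l : nat,
    (N <= l)%N -> (q * count_in S m l <= l)%N.

Lemma count_in_add S m a b :
  count_in S m (a + b) = (count_in S m a + count_in S (m + a) b)%N.
Proof. by rewrite /count_in addnA (big_cat_nat (n := m + a))//= leq_addr. Qed.

Lemma count_in_recl S m l :
  count_in S m l.+1 = ((m \in S) + count_in S m.+1 l)%N.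
Proof. by rewrite -add1n count_in_add /count_in addn1 big_nat1. Qed.

Lemma count_in_sum S (K : nat) (F : nat -> set nat) m l :
  (forall n, (n \in S) <= \sum_(k < K) (n \in F k))%N ->
  (count_in S m l <= \sum_(k < K) count_in (F k) m l)%N.
Proof. by move=> SF; rewrite /count_in exchange_big leq_sum. Qed.

Definition separated (K : nat) (S : set nat) : Prop :=
  forall n k, (0 < k < K)%N -> S n -> ~ S (n + k)%N.

Lemma count_in_window K S m l :
  separated K S -> (l <= K)%N -> (count_in S m l <= 1)%N.
Proof.
move=> sepS; elim: l m => [|l IHl] m lK.
  by rewrite /count_in addn0 big_geq.
rewrite count_in_recl; have [mS|_] := boolP (m \in S); last exact/IHl/ltnW.
rewrite /count_in big_nat big1 ?addn0// => n /andP[mn nl].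
apply/eqP; rewrite eqb0 -(subnKC (ltnW mn)); apply/negP; rewrite inE.
by apply: sepS; [lia|rewrite inE in mS].
Qed.

(** Cut the interval into windows of length [K], each with at most one element; the summand [K] pays
    for the last, partial window. *)
Lemma count_in_separated K S m l :
  separated K S -> (K * count_in S m l <= K + l)%N.
Proof.
move=> sepS; have [n] := ubnP l; elim: n l m => // n IHn l m ln.
have [lK|Kl] := leqP l K; first by have := count_in_window m sepS lK; nia.
have [K0|K0] := posnP K; first by rewrite K0.
rewrite -(subnKC (ltnW Kl)) count_in_add.
have := count_in_window m sepS (leqnn K).
have := IHn (l - K)%N (m + K)%N.
set c := count_in _ m _; set d := count_in _ _ _; nia.
Qed.

(* The elements of [S] that are not followed by another element of [S] at      *)
(* distance less than [K] have density at most [1 / K].                        *)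
Lemma zero_density_shifts (S : set nat) :
  (forall k, (0 < k)%N -> zero_density (S `&` [set n | S (n + k)%N])) ->
  zero_density S.
Proof.
move=> Sk q; pose K := (4 * q).+1.
pose F k :=
  if k is 0 then [set n | S n /\ forall j, (0 < j < K)%N -> ~ S (n + j)%N]
  else S `&` [set n | S (n + k)%N].
(* Each of the [4 * q] shifts gets proportion at most 1 / ([4 * q * K]), so together they contribute
   at most [l] / [K]. *)
have /choice[N NP] k : exists N, forall m l, (N <= l)%N ->
    (0 < k)%N -> (4 * q * K * count_in (F k) m l <= l)%N.
  case: k => [|k]; first by exists 0%N.
  have [N NP] := Sk k.+1 isT (4 * q * K)%N.
  by exists N => m l Nl _; exact: NP.
(* In total [count_in S m l] is at most 1 + 2 [l] / [K]; the bound [4 * q <= l] absorbs the 1 after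
   multiplication by [q]. *)
exists (maxn (4 * q) (\max_(k < K) N k)) => m l.
rewrite geq_max => /andP[ql Nl].
have cov : (count_in S m l <= \sum_(k < K) count_in (F k) m l)%N.
  apply: count_in_sum => n; have [nS|//] := boolP (n \in S).
  have [[k [kK Snk]]|nex] :=
      pselect (exists k, (0 < k < K)%N /\ S (n + k)%N).
    have kK' : (k < K)%N by case/andP: kK.
    rewrite (bigD1 (Ordinal kK'))//= (_ : n \in F k) ?leq_addr//.
    rewrite inE; case: k kK {kK'} Snk => // k _ Snk.
    by split=> //; rewrite inE in nS.
  rewrite big_ord_recl/= (_ : n \in F 0%N)//.
  rewrite inE; split; first by rewrite inE in nS.
  by move=> j jK Sj; apply: nex; exists j.
have F0 : (K * count_in (F 0%N) m l <= K + l)%N.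
  apply: count_in_separated => n j jK [_ nS] [Snj _]; exact: nS jK Snj.
have Fk : (K * \sum_(k < 4 * q) (4 * q * count_in (F (lift ord0 k)) m l)
             <= 4 * q * l)%N.
  rewrite big_distrr/= -[X in (_ <= X * l)%N]card_ord -sum_nat_const.
  apply: leq_sum => k _; rewrite mulnCA mulnA; apply: (NP (lift ord0 k)) => //.
  apply: leq_trans Nl.
  exact: (leq_bigmax (F := fun k : 'I_K => N k) (lift ord0 k)).
move: cov F0 Fk; rewrite big_ord_recl -big_distrr /=.
set c := count_in S m l; set c0 := count_in _ m l; set s := (\sum_(_ < _) _)%N.
rewrite /K; nia.
Qed.

Lemma not_zero_density_nonempty (S : set nat) : ~ zero_density S -> S !=set0.
Proof.
move=> nS; apply: contrapT => S0; apply: nS => q; exists 0%N => m l _.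
rewrite /count_in big1 ?muln0// => n _; apply/eqP; rewrite eqb0.
by apply/negP; rewrite inE => Sn; apply: S0; exists n.
Qed.

Lemma banach_density_eq0 (R : realType) (S : set nat) :
  zero_density S -> banach_density R S = 0%E.
Proof.
move=> dS; apply/eqP; rewrite eq_le; apply/andP; split; last first.
  (* Lower bound: every set of the filter contains an interval, whose density is nonnegative. *)
  apply/ereal_infP => _ [P [N NP] <-].
  apply: (@le_trans _ _ (interval_density R S (0%N, N))%:E).
    by rewrite lee_fin divr_ge0.
  by apply: ereal_sup_ubound; exists (0%N, N) => //; exact: NP.
apply/lee_addgt0Pr => e e0; rewrite add0e.
have [N NP] := dS (Num.truncn e^-1).+1.
apply: ge_ereal_inf.
exists (ereal_sup [set (interval_density R S I)%:E |
                   I in [set I | (N <= I.2)%N]]).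
  by exists [set I | (N <= I.2)%N] => //; exists N.
apply: ge_ereal_sup => _ [[m l] /= Nl <-]; rewrite lee_fin /interval_density/=.
(* [N] may be 0; the density at length 0 is 0 because division by zero gives 0. *)
have [->|l0] := posnP l; first by rewrite invr0 mulr0 ltW.
rewrite ler_pdivrMr ?ltr0n//.
have qe : e^-1 <= (Num.truncn e^-1).+1%:R by rewrite ltW// truncnS_gt.
rewrite mulrC -ler_pdivrMr// mulrC.
apply: (le_trans (ler_wpM2r (ler0n _ _) qe)).
by rewrite -natrM ler_nat; exact: NP.
Qed.

(** * Closed subsets of the spectrum and their return times *)

Definition vanishing_ideal (A : comNzRingType) (V : set (Spec A)) : set A :=
  [set f | forall p, V p -> f \in (p : prime_idealr A)].

Lemma is_ideal_vanishing (A : comNzRingType) (V : set (Spec A)) :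
  is_ideal (vanishing_ideal V).
Proof.
split=> [p _|f g If Ig p Vp|a f If p Vp]; first exact: idealr0.
- by apply: rpredD; [exact: If|exact: Ig].
- by apply: idealMr; exact: If.
Qed.

Lemma zero_locus_vanishing (A : comNzRingType) (V : set (Spec A)) :
  zariski_closed V -> zero_locus (vanishing_ideal V) = V.
Proof.
move=> [E ->]; apply/seteqP; split=> [p pV f Ef|p Vp f If]; last exact: If.
by apply: pV => q; exact.
Qed.

(** Passing to vanishing ideals reverses inclusions and loses nothing on closed sets, so a maximal
    ideal of the family yields a minimal closed set. *)
Lemma zariski_closed_min (A : comNzRingType) (F : set (set (Spec A))) :
  noetherian A -> F `<=` @zariski_closed A -> F !=set0 ->
  exists2 V, F V & forall W, F W -> W `<=` V -> V `<=` W.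
Proof.
move=> nA cF [V0 FV0].
have [_ [V FV <-] Vmax] : exists2 I, (@vanishing_ideal A @` F) I &
    forall J, (@vanishing_ideal A @` F) J -> I `<=` J -> J `<=` I.
  apply: noetherian_max => // [_ [V FV <-]|]; first exact: is_ideal_vanishing.
  by exists (vanishing_ideal V0); exists V0.
exists V => // W FW WV p Vp; rewrite -(zero_locus_vanishing (cF _ FW)) => f Wf.
suff Vf : vanishing_ideal V f by exact: Vf.
apply: (Vmax (vanishing_ideal W)) Wf; first by exists W.
by move=> g Ig q /WV; exact: Ig.
Qed.

Lemma mem_iter_Spec_map (A : comNzRingType) (Phi : {rmorphism A -> A}) n
  (p : Spec A) f :
  (f \in (iter n (Spec_map Phi) p : prime_idealr A)) =
  (iter n Phi f \in (p : prime_idealr A)).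
Proof. by elim: n f => // n IHn f; rewrite [iter _ Phi f]iterSr; exact: IHn. Qed.

(** The preimage of the zero locus of [E] under the [n]-th iterate is the zero locus of the image of
    [E] under [iter n Phi]. *)
Lemma zariski_closed_return (A : comNzRingType) (Phi : {rmorphism A -> A}) n
  (V : set (Spec A)) : zariski_closed V ->
  zariski_closed (V `&` iter n (Spec_map Phi) @^-1` V).
Proof.
move=> [E ->]; exists (E `|` iter n Phi @` E).
apply/seteqP; split=> [p [pE pE'] f [/pE//|[g Eg <-]]|p pE].
  by rewrite -mem_iter_Spec_map; exact: pE'.
split=> f Ef; first by apply: pE; left.
by rewrite mem_iter_Spec_map; apply: pE; right; exists f.
Qed.

Theorem theorem1 (R : realType) (k : fieldType) (A : comAlgType k)
  (hA : finitely_generated_algebra A)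
  (Phi : {lrmorphism A -> A}) (alpha : Spec A)
  (V : set (Spec A)) (hV : zariski_closed V) :
  let phi : Spec A -> Spec A := Spec_map Phi in
  let return_set : set nat := [set n : nat | V (iter n phi alpha)]%classic in
  (forall a b : nat, (1 <= a)%N ->
    ~ (arithmetic_progression a b `<=` return_set)%classic) ->
  banach_density R return_set = 0%E.
Proof.
move=> phi return_set noAP; apply: banach_density_eq0; apply: contrapT => dV.
pose ret (W : set (Spec A)) := [set n | W (iter n phi alpha)].
have [W [[cW WV] dW] Wmin] : exists2 W,
    [set W | (zariski_closed W /\ W `<=` V) /\ ~ zero_density (ret W)] W &
    forall W', [set W | (zariski_closed W /\ W `<=` V) /\
      ~ zero_density (ret W)] W' -> W' `<=` W -> W `<=` W'.
  apply: zariski_closed_min; first exact: finitely_generated_noetherian hA.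
    by move=> W [[]].
  by exists V; do !split.
have [a [a0 da]] : exists a, (0 < a)%N /\
    ~ zero_density (ret W `&` [set n | ret W (n + a)%N]).
  apply: contrapT => na; apply: dW; apply: zero_density_shifts => a a0.
  by apply: contrapT => da; apply: na; exists a.
have Wa : W `<=` W `&` iter a phi @^-1` W.
  apply: Wmin => [|p []//]; split; last first.
    (* The return set of the smaller closed set is exactly the intersection in [da]. *)
    move: da; congr (~ zero_density _); apply/funext => n.
    by rewrite /ret/setI/= addnC iterD.
  by split; [exact: zariski_closed_return|move=> p [/WV]].
have [b Wb] := not_zero_density_nonempty dW.
apply: (noAP a b a0) => _ [l _ <-]; apply: WV.
elim: l => [|l IHl]; first by rewrite muln0.
by rewrite mulnS -addnA iterD; exact: (Wa _ IHl).2.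
Qed.
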